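(* Let $G_1$ and $G_2$ be graphs with disjoint vertex sets. Then $\mathrm{indthin}(G_1\vee G_2)=\mathrm{indthin}(G_1)+\mathrm{indthin}(G_2)$ and $\mathrm{indpthin}(G_1\vee G_2)=\mathrm{indpthin}(G_1)+\mathrm{indpthin}(G_2)$.
   Context: Graphs are finite, simple, undirected. The join $G_1\vee G_2$ has vertex set $V_1\cup V_2$ and edge set $E_1\cup E_2\cup\{vv': v\in V_1, v'\in V_2\}$. For a graph $G=(V,E)$, an ordering $v_1,\dots,v_n$ of $V$ and a partition of $V$ are consistent if for every $r<s<t$, whenever $v_r,v_s$ are in the same class and $v_tv_r\in E$, then $v_tv_s\in E$; they are strongly consistent if moreover for every $r<s<t$, whenever $v_s,v_t$ are in the same class and $v_tv_r\in E$, then $v_sv_r\in E$. $\mathrm{indthin}(G)$ is the minimum $k$ such that some ordering of $V$ and some partition of $V$ into $k$ independent sets are consistent; $\mathrm{indpthin}(G)$ is defined likewise with strongly consistent. *)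

(* Defs.v *)
From HB Require Import structures.
From mathcomp Require Import all_boot.
Set Implicit Arguments.
Unset Strict Implicit.
Unset Printing Implicit Defensive.

Record sgraph := SGraph {
  vertex :> finType;
  adj : rel vertex;
  adj_sym : symmetric adj;
  adj_irrefl : irreflexive adj }.

Section Join.
Variables G1 G2 : sgraph.

Definition join_adj : rel (G1 + G2)%type := fun x y =>
  match x, y with
  | inl u, inl v => adj u v
  | inr u, inr v => adj u v
  | _, _ => true
  end.

Lemma join_adj_sym : symmetric join_adj.
Proof. by move=> [u|u] [v|v] //=; apply: adj_sym. Qed.

Lemma join_adj_irrefl : irreflexive join_adj.
Proof. by move=> [u|u] /=; apply: adj_irrefl. Qed.

(* The sum type makes the two vertex sets disjoint. *)
Definition join : sgraph := SGraph join_adj_sym join_adj_irrefl.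
End Join.

Section Thinness.
Variable G : sgraph.

Definition same_class (P : {set {set G}}) (x y : G) : bool :=
  [exists C in P, (x \in C) && (y \in C)].

Definition independent (C : {set G}) : bool :=
  [forall x in C, forall y in C, ~~ adj x y].

(* An injection from 'I_#|G| to G is a bijection, i.e. v_1, ..., v_n lists
   every vertex exactly once. *)
Definition ordering (v : {ffun 'I_#|G| -> G}) : bool := injectiveb v.

Definition consistent (v : {ffun 'I_#|G| -> G}) (P : {set {set G}}) : bool :=
  [forall r : 'I_#|G|, forall s : 'I_#|G|, forall t : 'I_#|G|,
    [&& r < s, s < t, same_class P (v r) (v s) & adj (v t) (v r)]
      ==> adj (v t) (v s)].

Definition strongly_consistent (v : {ffun 'I_#|G| -> G}) (P : {set {set G}})
    : bool :=
  consistent v P &&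
  [forall r : 'I_#|G|, forall s : 'I_#|G|, forall t : 'I_#|G|,
    [&& r < s, s < t, same_class P (v s) (v t) & adj (v t) (v r)]
      ==> adj (v s) (v r)].

Definition indep_partition (P : {set {set G}}) (k : nat) : bool :=
  [&& partition P [set: G], #|P| == k & [forall C in P, independent C]].

Definition indthin_witness (k : nat) : bool :=
  [exists v : {ffun 'I_#|G| -> G}, exists P : {set {set G}},
    [&& ordering v, indep_partition P k & consistent v P]].

Definition indpthin_witness (k : nat) : bool :=
  [exists v : {ffun 'I_#|G| -> G}, exists P : {set {set G}},
    [&& ordering v, indep_partition P k & strongly_consistent v P]].

Lemma ex_indpthin : exists k, indpthin_witness k.
Proof.
pose P := [set [set x] | x in [set: G]].
pose v : {ffun 'I_#|G| -> G} := [ffun i => enum_val i].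
have sameE x y : same_class P x y -> x = y.
  by case/existsP=> C /andP[/imsetP[z _ ->]]; rewrite !inE => /andP[/eqP-> /eqP->].
have vinj : injective v by move=> i j; rewrite !ffunE; apply: enum_val_inj.
exists #|P|; apply/existsP; exists v; apply/existsP; exists P.
apply/and3P; split; first exact/injectiveP.
- apply/and3P; split=> //.
    apply/and3P; split.
    + apply/eqP/setP=> x; rewrite inE; apply/bigcupP; exists [set x].
        by apply/imsetP; exists x; rewrite ?inE.
      by rewrite inE.
    + apply/trivIsetP=> _ _ /imsetP[x _ ->] /imsetP[y _ ->] nxy.
      by rewrite disjoints1 inE; apply: contra nxy => /eqP->.
    + by apply/imsetP=> -[x _] /setP/(_ x); rewrite !inE eqxx.
  apply/forall_inP=> _ /imsetP[x _ ->].
  apply/forall_inP=> y /set1P->; apply/forall_inP=> z /set1P->.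
  by rewrite adj_irrefl.
- apply/andP; split; apply/forallP=> r; apply/forallP=> s; apply/forallP=> t.
    by apply/implyP=> /and4P[_ _ /sameE->].
  by apply/implyP=> /and4P[_ _ /sameE->].
Qed.

Lemma ex_indthin : exists k, indthin_witness k.
Proof.
have [k /existsP[v /existsP[P /and3P[ov iP /andP[cv _]]]]] := ex_indpthin.
by exists k; apply/existsP; exists v; apply/existsP; exists P; apply/and3P.
Qed.

Definition indthin : nat := ex_minn ex_indthin.
Definition indpthin : nat := ex_minn ex_indpthin.
End Thinness.

(* Main.v *)
Require Import Defs.
From mathcomp Require Import all_boot.

Set Implicit Arguments.
Unset Strict Implicit.
Unset Printing Implicit Defensive.

(** An ordering and a consistent partition into independent sets amount to an
    injective position function together with a proper colouring whose fibres
    are the classes. Such layouts of [G1] and [G2] combine by placing all of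
    [G1] before all of [G2] and using disjoint palettes: a vertex of one side is
    adjacent to the whole other side, so no mixed triple violates consistency.
    Conversely a layout of the join restricts to both sides, and the two sides
    use disjoint palettes because vertices of opposite sides are adjacent. *)

Lemma card_preim_partition (aT rT : finType) (f : aT -> rT) (D : {set aT}) :
  #|preim_partition f D| = #|f @: D|.
Proof.
have -> : preim_partition f D = [set [set y in D | a == f y] | a in f @: D].
  by rewrite -imset_comp.
apply: card_in_imset => _ b /imsetP[x xD ->] _ /setP/(_ x).
by rewrite !inE xD eqxx => /esym/eqP.
Qed.

Lemma imset_sum (A B T : finType) (f : A + B -> T) :
  f @: [set: A + B] =
    (f \o inl) @: [set: A] :|: (f \o inr) @: [set: B].
Proof.
apply/setP=> t; rewrite inE; apply/imsetP/orP.
  by case=> -[x|x] _ ->; [left | right]; apply/imsetP; exists x; rewrite ?inE.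
by case=> /imsetP[x _ ->]; [exists (inl x) | exists (inr x)]; rewrite ?inE.
Qed.

Definition num_colors (V T : finType) (c : V -> T) : nat := #|c @: [set: V]|.

Definition color_classes (V T : finType) (c : V -> T) : {set {set V}} :=
  preim_partition c [set: V].

Lemma card_color_classes (V T : finType) (c : V -> T) :
  #|color_classes c| = num_colors c.
Proof. exact: card_preim_partition. Qed.

Lemma color_classes_pblock (V : finType) (P : {set {set V}}) :
  partition P [set: V] -> color_classes (pblock P) = P.
Proof. exact: preim_partition_pblock. Qed.

Lemma num_colors_comp_inj (V T U : finType) (f : T -> U) (c : V -> T) :
  injective f -> num_colors (f \o c) = num_colors c.
Proof. by move=> f_inj; rewrite /num_colors imset_comp card_imset. Qed.

Lemma num_colors_sum (A B T : finType) (c : A + B -> T) :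
  (forall a b, c (inl a) <> c (inr b)) ->
  num_colors c = num_colors (c \o inl) + num_colors (c \o inr).
Proof.
move=> c_neq; rewrite /num_colors imset_sum.
apply/eqP; rewrite (leq_card_setU _ _) disjoint_subset.
by apply/subsetP=> _ /imsetP[a _ ->]; rewrite inE; apply/imsetP=> -[b _ /c_neq].
Qed.

Definition proper_coloring (G : sgraph) (T : Type) (c : G -> T) : Prop :=
  forall x y, c x = c y -> ~~ adj x y.

Section ColoringPartitions.
Variables (G : sgraph) (T : finType) (c : G -> T).

Lemma same_color_class x y : same_class (color_classes c) x y = (c x == c y).
Proof.
apply/existsP/eqP=> [[C /and3P[/imsetP[z _ ->]]] | c_xy].
  by rewrite !inE => /eqP<- /eqP<-.
exists [set z in [set: G] | c x == c z].
by rewrite !inE c_xy eqxx !andbT -c_xy; apply/imsetP; exists x.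
Qed.

Lemma indep_color_classes :
  reflect (proper_coloring c)
    (indep_partition (color_classes c) (num_colors c)).
Proof.
rewrite /indep_partition preim_partitionP card_color_classes eqxx.
apply: (iffP forall_inP) => [indep x y /eqP | proper C classC].
  rewrite -same_color_class => /existsP[C /and3P[/indep/forall_inP indC xC yC]].
  by move/indC/forall_inP: xC; apply.
apply/forall_inP=> x xC; apply/forall_inP=> y yC; apply/proper/eqP.
by rewrite -same_color_class; apply/existsP; exists C; apply/and3P.
Qed.

End ColoringPartitions.

Section Orderings.
Variables (G : sgraph) (pos : G -> nat).

Definition increasing (v : {ffun 'I_#|G| -> G}) : Prop :=
  forall i j : 'I_#|G|, (pos (v i) < pos (v j)) = (i < j).

Lemma increasing_ordering_exists :
  injective pos -> exists2 v, ordering v & increasing v.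
Proof.
move=> pos_inj; pose s := sort (relpre pos leq) (enum G).
have size_s : size s = #|G| by rewrite size_sort cardE.
have sorted_s : sorted ltn (map pos s).
  rewrite ltn_sorted_uniq_leq map_inj_uniq // sort_uniq enum_uniq.
  by rewrite -sort_map sort_sorted //; apply: leq_total.
pose v := [ffun i : 'I_#|G| => nth (enum_val i) s i].
have pos_v i : pos (v i) = nth 0 (map pos s) i.
  by rewrite ffunE (nth_map (enum_val i)) ?size_s.
have v_homo (i j : 'I_#|G|) : i < j -> pos (v i) < pos (v j).
  rewrite !pos_v; apply: (sorted_ltn_nth ltn_trans 0 sorted_s);
    by rewrite inE size_map size_s.
exists v; last first.
  move=> i j; case: (ltngtP i j) => [|/v_homo/ltnW|/val_inj->].
  - exact: v_homo.
  - by rewrite ltnNge => ->.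
  - exact: ltnn.
apply/injectiveP=> i j eq_v; apply/val_inj.
by case: (ltngtP i j) => // /v_homo; rewrite eq_v ltnn.
Qed.

End Orderings.

Lemma ordering_bij (G : sgraph) (v : {ffun 'I_#|G| -> G}) :
  ordering v -> bijective v.
Proof. by move/injectiveP=> v_inj; apply: inj_card_bij; rewrite ?card_ord. Qed.

Lemma increasing_position_exists (G : sgraph) (v : {ffun 'I_#|G| -> G}) :
  ordering v -> exists2 pos : G -> nat, injective pos & increasing pos v.
Proof.
case/ordering_bij=> rank vK rankK.
exists (val \o rank); first exact: inj_comp val_inj (can_inj rankK).
by move=> i j; rewrite /= !vK.
Qed.

Definition consistency (strong : bool) (G : sgraph) (v : {ffun 'I_#|G| -> G})
    (P : {set {set G}}) : bool :=
  if strong then strongly_consistent v P else consistent v P.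

Section IncreasingTriples.
Variables (G : sgraph) (pos : G -> nat) (v : {ffun 'I_#|G| -> G}).
Hypotheses (v_ord : ordering v) (v_incr : increasing pos v).

Lemma increasing_triplesP (A B C : G -> G -> G -> bool) :
  reflect
    (forall x y z, pos x < pos y < pos z -> A x y z -> B x y z -> C x y z)
    [forall r : 'I_#|G|, forall s : 'I_#|G|, forall t : 'I_#|G|,
      [&& r < s, s < t, A (v r) (v s) (v t) & B (v r) (v s) (v t)]
        ==> C (v r) (v s) (v t)].
Proof.
apply: (iffP 'forall_'forall_'forall_implyP) => [ABC x y z | ABC r s t].
  have [rank _ rankK] := ordering_bij v_ord.
  rewrite -[x]rankK -[y]rankK -[z]rankK !v_incr => /andP[lt_xy lt_yz] Axyz Bxyz.
  by apply: ABC; apply/and4P.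
by case/and4P=> lt_rs lt_st; apply: ABC; rewrite !v_incr lt_rs.
Qed.

Lemma consistencyP (strong : bool) (P : {set {set G}}) :
  reflect
    ((forall x y z, pos x < pos y < pos z -> same_class P x y ->
        adj z x -> adj z y) /\
     (strong -> forall x y z, pos x < pos y < pos z -> same_class P y z ->
        adj z x -> adj y x))
    (consistency strong v P).
Proof.
have conP := increasing_triplesP (fun x y _ => same_class P x y)
  (fun x _ z => adj z x) (fun _ y z => adj z y).
have strongP := increasing_triplesP (fun _ y z => same_class P y z)
  (fun x _ z => adj z x) (fun x y _ => adj y x).
case: strong; last by apply: (iffP conP) => [|[]].
by apply: (iffP andP) => [[/conP con /strongP] | [/conP con /(_ isT)/strongP]].
Qed.

End IncreasingTriples.

Record layout (strong : bool) (G : sgraph) (T : Type) (pos : G -> nat)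
    (c : G -> T) : Prop := {
  layout_inj : injective pos;
  layout_proper : proper_coloring c;
  layout_consistent : forall x y z, pos x < pos y < pos z ->
    c x = c y -> adj z x -> adj z y;
  layout_strongly_consistent : strong -> forall x y z, pos x < pos y < pos z ->
    c y = c z -> adj z x -> adj y x }.

Lemma layoutP strong (G : sgraph) (T : finType) (pos : G -> nat) (c : G -> T)
    (v : {ffun 'I_#|G| -> G}) :
    ordering v -> increasing pos v -> injective pos ->
  reflect (layout strong pos c)
    (indep_partition (color_classes c) (num_colors c) &&
     consistency strong v (color_classes c)).
Proof.
move=> v_ord v_incr pos_inj; apply: (iffP andP).
  case=> /indep_color_classes proper.
  case/(consistencyP v_ord v_incr)=> con strong_con.
  split=> // [x y z lt_xyz c_xy | st x y z lt_xyz c_yz].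
    by apply: con lt_xyz _; rewrite same_color_class c_xy.
  by apply: strong_con lt_xyz _ => //; rewrite same_color_class c_yz.
case=> _ proper con strong_con; split; first exact/indep_color_classes.
apply/(consistencyP v_ord v_incr).
split=> [|st] x y z lt_xyz; rewrite same_color_class => /eqP; first exact: con.
exact: strong_con.
Qed.

Lemma layout_induced strong (H G : sgraph) (T : Type) (pos : G -> nat)
    (c : G -> T) (h : H -> G) :
    injective h -> (forall x y, adj (h x) (h y) = adj x y) ->
  layout strong pos c -> layout strong (pos \o h) (c \o h).
Proof.
move=> h_inj h_adj [pos_inj proper con strong_con].
split=> [|x y /=|x y z /=|st x y z /=]; rewrite -?h_adj.
- exact: inj_comp.
- exact: proper.
- exact: con.
- exact: strong_con.
Qed.

Section Join.
Variables G1 G2 : sgraph.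

Definition join_position (p1 : G1 -> nat) (p2 : G2 -> nat)
    (x : join G1 G2) : nat :=
  match x with
  | inl u => p1 u
  | inr w => (\max_u p1 u).+1 + p2 w
  end.

Definition join_coloring (T1 T2 : Type) (c1 : G1 -> T1) (c2 : G2 -> T2)
    (x : join G1 G2) : T1 + T2 :=
  match x with
  | inl u => inl (c1 u)
  | inr w => inr (c2 w)
  end.

Lemma join_position_lt p1 p2 (u : G1) (w : G2) :
  join_position p1 p2 (inl u) < join_position p1 p2 (inr w).
Proof. by rewrite ltnS (leq_trans (leq_bigmax u)) ?leq_addr. Qed.

Lemma join_position_inj p1 p2 :
  injective p1 -> injective p2 -> injective (join_position p1 p2).
Proof.
move=> inj1 inj2 [u|w] [u'|w'] eq_pos; first by congr inl; apply: inj1.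
- by have := join_position_lt p1 p2 u w'; rewrite eq_pos ltnn.
- by have := join_position_lt p1 p2 u' w; rewrite eq_pos ltnn.
by congr inr; apply/inj2/(addnI eq_pos).
Qed.

Lemma layout_join strong (T1 T2 : Type) p1 p2 (c1 : G1 -> T1) (c2 : G2 -> T2) :
    layout strong p1 c1 -> layout strong p2 c2 ->
  layout strong (join_position p1 p2) (join_coloring c1 c2).
Proof.
case=> [inj1 prop1 con1 scon1] [inj2 prop2 con2 scon2].
have not_lt21 u w :
    join_position p1 p2 (inr w) < join_position p1 p2 (inl u) = false.
  by rewrite ltnNge ltnW ?join_position_lt.
split; first exact: join_position_inj.
- by move=> [u|u] [w|w] //= [] => [/prop1 | /prop2].
- move=> [x|x] [y|y] [z|z];
    rewrite ?not_lt21 ?andbF //= ?ltn_add2l => lt_xyz //.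
    by case; apply: con1.
  by case; apply: con2.
- move=> st [x|x] [y|y] [z|z];
    rewrite ?not_lt21 ?andbF //= ?ltn_add2l => lt_xyz //.
    by case; apply: scon1.
  by case; apply: scon2.
Qed.

Lemma num_colors_join (T : finType) (c : join G1 G2 -> T) :
  proper_coloring c ->
  num_colors c =
    num_colors (c \o inl : G1 -> T) + num_colors (c \o inr : G2 -> T).
Proof. by move=> proper; apply: num_colors_sum => u w /proper. Qed.

Lemma num_colors_join_coloring (T1 T2 : finType) (c1 : G1 -> T1)
    (c2 : G2 -> T2) :
  num_colors (join_coloring c1 c2) = num_colors c1 + num_colors c2.
Proof.
rewrite -(num_colors_comp_inj c1 (@inl_inj T1 T2)).
rewrite -(num_colors_comp_inj c2 (@inr_inj T1 T2)).
exact: num_colors_sum.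
Qed.

End Join.

Definition thinness (strong : bool) (G : sgraph) : nat :=
  if strong then indpthin G else indthin G.

Definition thinness_witness (strong : bool) (G : sgraph) (k : nat) : bool :=
  [exists v : {ffun 'I_#|G| -> G}, exists P : {set {set G}},
    [&& ordering v, indep_partition P k & consistency strong v P]].

Lemma thinness_attained strong G :
  thinness_witness strong G (thinness strong G).
Proof.
by case: strong; rewrite /thinness /indthin /indpthin; case: ex_minnP.
Qed.

Lemma thinness_min strong G k :
  thinness_witness strong G k -> thinness strong G <= k.
Proof.
by case: strong; rewrite /thinness /indthin /indpthin; case: ex_minnP => m _;
  apply.
Qed.

Lemma thinness_le_num_colors strong (G : sgraph) (T : finType) (pos : G -> nat)
    (c : G -> T) :
  layout strong pos c -> thinness strong G <= num_colors c.
Proof.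
move=> layout_c; have pos_inj := layout_inj layout_c.
have [v v_ord v_incr] := increasing_ordering_exists pos_inj.
apply/thinness_min/existsP; exists v; apply/existsP; exists (color_classes c).
by rewrite v_ord; apply/(layoutP strong c v_ord v_incr pos_inj).
Qed.

Lemma optimal_layout_exists strong (G : sgraph) :
  exists (pos : G -> nat) (c : G -> {set G}),
    layout strong pos c /\ num_colors c = thinness strong G.
Proof.
have /existsP[v /existsP[P /and3P[v_ord indepP conP]]] :=
  thinness_attained strong G.
have /and3P[partP /eqP cardP _] := indepP.
have classesE := color_classes_pblock partP.
have num_classes : num_colors (pblock P) = thinness strong G.
  by rewrite -card_color_classes classesE.
have [pos pos_inj v_incr] := increasing_position_exists v_ord.
exists pos, (pblock P); split=> //.
apply/(layoutP strong _ v_ord v_incr pos_inj).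
by rewrite classesE num_classes indepP.
Qed.

Lemma thinness_join strong (G1 G2 : sgraph) :
  thinness strong (join G1 G2) = thinness strong G1 + thinness strong G2.
Proof.
apply/eqP; rewrite eqn_leq; apply/andP; split.
  have [p1 [c1 [layout1 <-]]] := optimal_layout_exists strong G1.
  have [p2 [c2 [layout2 <-]]] := optimal_layout_exists strong G2.
  rewrite -num_colors_join_coloring.
  exact: thinness_le_num_colors (layout_join layout1 layout2).
have [pos [c [layout_c <-]]] := optimal_layout_exists strong (join G1 G2).
rewrite (num_colors_join (layout_proper layout_c)); apply: leq_add.
  apply/thinness_le_num_colors/(layout_induced _ _ layout_c) => //.
  exact: inl_inj.
apply/thinness_le_num_colors/(layout_induced _ _ layout_c) => //.
exact: inr_inj.
Qed.

Theorem theorem4p11 (G1 G2 : sgraph) :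
  indthin (join G1 G2) = indthin G1 + indthin G2 /\
  indpthin (join G1 G2) = indpthin G1 + indpthin G2.
Proof. exact: conj (thinness_join false G1 G2) (thinness_join true G1 G2). Qed.
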